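(* Let $G$ be a finite simple graph. If there is an independent set $S$ in $G$ such that $|N(A)\cap S|=2|A|$ holds for every independent set $A\subseteq V(G)\setminus S$, then the independence polynomial $I(G;x)$ is symmetric and unimodal.
   Context: For a finite simple graph $G$, $i_k(G)$ is the number of independent sets of size $k$ ($i_0(G)=1$), $\alpha(G)$ is the maximum size of an independent set, and $I(G;x)=\sum_{k=0}^{\alpha(G)} i_k(G)x^k$. For $A\subseteq V(G)$, $N(A)$ is the set of vertices adjacent to at least one vertex of $A$. A polynomial $\sum_{k=0}^n a_kx^k$ of degree $n$ with nonnegative coefficients is symmetric if $a_k=a_{n-k}$ for all $0\le k\le n$, and unimodal if there is $m$ with $a_0\le\cdots\le a_m\ge\cdots\ge a_n$. *)

(* Defs.v *)
From HB Require Import structures.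
From mathcomp Require Import all_boot all_order all_algebra.
Set Implicit Arguments.
Unset Strict Implicit.
Unset Printing Implicit Defensive.
Import Order.TTheory GRing.Theory Num.Theory.
Local Open Scope ring_scope.

Record sgraph := SGraph {
  vertex :> finType;
  adj : rel vertex;
  adj_sym : symmetric adj;
  adj_irr : irreflexive adj
}.

Definition independent (G : sgraph) (A : {set G}) : bool :=
  [forall u in A, forall v in A, ~~ adj u v].

Definition nbhd (G : sgraph) (A : {set G}) : {set G} :=
  [set v | [exists u in A, adj u v]].

Definition indep_count (G : sgraph) (k : nat) : nat :=
  #|[set A : {set G} | independent A & #|A| == k]|.

Definition indep_number (G : sgraph) : nat :=
  (\max_(A : {set G} | independent A) #|A|)%N.

Definition indep_poly (G : sgraph) : {poly int} :=
  \sum_(k < (indep_number G).+1) (indep_count G k)%:R *: 'X^k.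

(* The degree of [p] is [(size p).-1]. *)
Definition symmetric_poly (R : numDomainType) (p : {poly R}) : Prop :=
  p \is a polyOver Num.nneg /\
  forall k : nat, (k <= (size p).-1)%N -> p`_k = p`_((size p).-1 - k).

Definition unimodal_poly (R : numDomainType) (p : {poly R}) : Prop :=
  p \is a polyOver Num.nneg /\
  exists m : nat, [/\ (m <= (size p).-1)%N,
    forall i : nat, (i < m)%N -> p`_i <= p`_i.+1 &
    forall i : nat, (m <= i < (size p).-1)%N -> p`_i.+1 <= p`_i].

(* Main.v *)
Require Import Defs.
From mathcomp Require Import all_boot all_order all_algebra.
From mathcomp Require Import zify.
Set Implicit Arguments.
Unset Strict Implicit.
Unset Printing Implicit Defensive.

(** An independent set splits uniquely as [A :|: C] with [A] independent outside
    [S] and [C] a subset of [S] avoiding the neighbours of [A]. With [s = #|S|]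
    this gives [I(G; x) = \sum_A x^|A| (1 + x)^(s - 2|A|)], and every summand is
    symmetric about [s/2] and unimodal. *)

(** Since [(k+1) C(n,k+1) = (n-k) C(n,k)], it suffices that [k+1 <= n-k]. *)
Lemma leq_bin_succ (n k : nat) : k.*2 < n -> 'C(n, k) <= 'C(n, k.+1).
Proof.
move=> lt2kn; rewrite -(leq_pmul2l (ltn0Sn k)) mul_bin_left leq_mul2r.
by apply/orP; right; lia.
Qed.

(* The coefficient of [x ^ k] in [x ^ a * (1 + x) ^ (s - 2 a)]. *)
Definition shifted_bin (s a k : nat) : nat :=
  if a <= k then 'C(s - a.*2, k - a) else 0.

Lemma shifted_bin_gt (s a k : nat) : a.*2 <= s -> s < k -> shifted_bin s a k = 0.
Proof. by move=> ? ?; rewrite /shifted_bin; case: leqP => // ?; apply: bin_small; lia. Qed.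

Lemma shifted_bin_sym (s a k : nat) :
  a.*2 <= s -> k <= s -> shifted_bin s a (s - k) = shifted_bin s a k.
Proof.
move=> le2as leks; rewrite /shifted_bin.
case: (leqP a (s - k)) => [le_a_sk|lt_sk_a]; case: (leqP a k) => [leak|ltka] //.
- have -> : s - k - a = s - a.*2 - (k - a) by lia.
  by rewrite bin_sub //; lia.
(* In the mixed cases the one surviving binomial has lower index above [s - 2a], hence vanishes. *)
- by rewrite bin_small //; lia.
- by rewrite bin_small //; lia.
Qed.

(** For [a <= k], subtracting [2a] from [2k < s] keeps [k - a] in the rising half of row
    [s - 2a]. *)
Lemma shifted_bin_mono (s a k : nat) :
  k.*2 < s -> shifted_bin s a k <= shifted_bin s a k.+1.
Proof.
move=> lt2ks; rewrite /shifted_bin; case: (leqP a k) => // leak.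
by rewrite (leqW leak) subSn // leq_bin_succ //; lia.
Qed.

Lemma independentP (G : sgraph) (A : {set G}) :
  reflect (forall u v, u \in A -> v \in A -> ~~ adj u v) (independent A).
Proof.
apply: (iffP forallP) => [indA u v uA vA|indA u].
  by have /implyP/(_ uA)/forallP/(_ v)/implyP/(_ vA) := indA u.
by apply/implyP=> uA; apply/forallP=> v; apply/implyP; apply: indA.
Qed.

Lemma nbhdP (G : sgraph) (A : {set G}) (v : G) :
  reflect (exists2 u, u \in A & adj u v) (v \in nbhd A).
Proof.
by rewrite inE; apply: (iffP existsP) => [[u /andP[]]|[u uA uv]];
  exists u => //; rewrite uA.
Qed.

Lemma independent_sub (G : sgraph) (A B : {set G}) :
  A \subset B -> independent B -> independent A.
Proof.
move=> /subsetP sAB /independentP indB; apply/independentP=> u v uA vA.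
by apply: indB; apply: sAB.
Qed.

(** An edge inside the union lies in [A], lies in [C], or joins the two; the last kind puts a vertex
    of [C] into [nbhd A]. *)
Lemma independentU (G : sgraph) (A C : {set G}) :
  independent (A :|: C) =
  [&& independent A, independent C & [disjoint C & nbhd A]].
Proof.
apply/idP/and3P => [indAC|[indA indC disCA]].
  split; first exact: independent_sub (subsetUl A C) indAC.
    exact: independent_sub (subsetUr A C) indAC.
  apply/pred0P=> v /=; apply/negP=> /andP[vC /nbhdP[u uA uv]].
  have /independentP/(_ u v) := indAC.
  by rewrite !inE uA vC orbT uv => /(_ isT isT).
have nadj u v : u \in A -> v \in C -> ~~ adj u v.
  move=> uA vC; apply/negP=> uv.
  by have /nbhdP[] := disjointFr disCA vC; exists u.
apply/independentP=> u v /setUP[uA|uC] /setUP[vA|vC].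
- by have /independentP := indA; apply.
- exact: nadj.
- by rewrite adj_sym nadj.
- by have /independentP := indC; apply.
Qed.

(** Such a [B] is determined by [B :&: S], which ranges over the subsets of [S :\: nbhd A] of size
    [k - #|A|]; these are independent because [S] is. *)
Lemma card_independent_fiber (G : sgraph) (S A : {set G}) (k : nat) :
  independent S -> A \subset ~: S -> independent A ->
  #|[set B : {set G} | (independent B && (#|B| == k)) && (B :\: S == A)]| =
  if #|A| <= k then 'C(#|S :\: nbhd A|, k - #|A|) else 0.
Proof.
move=> indS sAS indA.
have disSA : [disjoint S & A] by rewrite disjoint_sym disjoints_subset.
case: leqP => [leAk|ltkA]; last first.
  apply: eq_card0 => B; rewrite !inE; apply/negP=> /andP[/andP[_ /eqP cB] /eqP dB].
  by move: ltkA; rewrite -cB -dB ltnNge subset_leq_card ?subsetDl.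
rewrite -cards_draws; apply: esym.
rewrite -(card_in_imset (f := fun C => A :|: C)); last first.
  move=> C D; rewrite !inE !subsetD => /andP[/andP[sCS _] _] /andP[/andP[sDS _] _] eqCD.
  (* Intersecting with [S] inverts [C |-> A :|: C], which gives injectivity. *)
  have key (E : {set G}) : E \subset S -> (A :|: E) :&: S = E.
    move=> sES; rewrite setIUl (setIidPl sES) setIC.
    by move: disSA; rewrite -setI_eq0 => /eqP ->; rewrite set0U.
  by rewrite -(key C) // eqCD key.
apply: eq_card => B; rewrite [RHS]inE; apply: esym; apply/idP/imsetP.
  move=> /andP[/andP[indB /eqP cB] /eqP dB].
  have defB : B = A :|: (B :&: S) by rewrite -dB setUC setID.
  exists (B :&: S) => //; rewrite inE subsetD subsetIr /=.
  move: (indB); rewrite {1}defB independentU => /and3P[_ _ ->] /=.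
  by rewrite -cB -(cardsID S B) dB addnK.
move=> [C]; rewrite inE subsetD => /andP[/andP[sCS disC] /eqP cC] ->.
have disAC : A :&: C = set0.
  by apply/eqP; rewrite setI_eq0 disjoint_sym (disjointWl sCS).
rewrite independentU indA disC (independent_sub sCS indS) /= cardsU disAC cards0.
rewrite subn0 cC subnKC // eqxx /= setDUl.
have /eqP -> : C :\: S == set0 by rewrite setD_eq0.
by rewrite setU0; apply/eqP/setDidPl; rewrite disjoint_sym.
Qed.

Section IndependenceNumbers.
Variables (G : sgraph) (S : {set G}).
Hypothesis S_indep : independent S.
Hypothesis nbhd_S : forall A : {set G}, A \subset ~: S -> independent A ->
  #|nbhd A :&: S| = 2 * #|A|.

(** The independent sets [B] are sorted by their part [B :\: S] outside [S]. *)
Lemma indep_countE (k : nat) :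
  indep_count G k =
  \sum_(A : {set G} | (A \subset ~: S) && independent A) shifted_bin #|S| #|A| k.
Proof.
rewrite /indep_count -sum1_card.
rewrite (partition_big (fun B => B :\: S)
  (fun A => (A \subset ~: S) && independent A)) /=; last first.
  move=> B; rewrite inE => /andP[indB _].
  by rewrite setDE subsetIr (independent_sub (subsetIl _ _) indB).
apply: eq_bigr => A /andP[sAS indA].
(* By hypothesis [nbhd A] removes exactly [2|A|] vertices from [S], so the fiber size depends on [A]
   only through [|A|]. *)
rewrite -[#|S|](cardsID (nbhd A)) setIC nbhd_S // /shifted_bin mul2n.
rewrite addKn -card_independent_fiber // -sum1_card.
by apply: eq_bigl => B; rewrite !inE.
Qed.

(** Guarantees that the truncated subtraction [|S| - 2|A|] in [shifted_bin] is exact. *)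
Lemma double_card_outside (A : {set G}) :
  (A \subset ~: S) && independent A -> #|A|.*2 <= #|S|.
Proof.
by move=> /andP[sAS indA]; rewrite -mul2n -nbhd_S // subset_leq_card ?subsetIr.
Qed.

Lemma indep_count_gt (k : nat) : #|S| < k -> indep_count G k = 0.
Proof.
move=> ltSk; rewrite indep_countE big1 // => A /double_card_outside le2A.
exact: shifted_bin_gt.
Qed.

Lemma indep_count_sym (k : nat) :
  k <= #|S| -> indep_count G (#|S| - k) = indep_count G k.
Proof.
move=> lekS; rewrite !indep_countE; apply: eq_bigr => A /double_card_outside le2A.
exact: shifted_bin_sym.
Qed.

Lemma indep_count_mono (k : nat) :
  k.*2 < #|S| -> indep_count G k <= indep_count G k.+1.
Proof.
move=> lt2kS; rewrite !indep_countE; apply: leq_sum => A _.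
exact: shifted_bin_mono.
Qed.

Lemma indep_count_anti (k : nat) :
  #|S| <= k.*2.+1 -> k < #|S| -> indep_count G k.+1 <= indep_count G k.
Proof.
(* Reflection turns the step from [k] to [k+1] into the step from [|S|-k] down to [|S|-k-1], which
   lies in the rising half. *)
move=> leS2k ltkS; rewrite -(indep_count_sym ltkS) -(indep_count_sym (ltnW ltkS)).
have -> : #|S| - k = (#|S| - k.+1).+1 by lia.
by apply: indep_count_mono; lia.
Qed.

Lemma indep_count_card_gt0 : 0 < indep_count G #|S|.
Proof. by apply/card_gt0P; exists S; rewrite inE S_indep eqxx. Qed.

End IndependenceNumbers.

Import Order.TTheory GRing.Theory Num.Theory.
Local Open Scope ring_scope.

Lemma coef_indep_poly (G : sgraph) (k : nat) :
  (indep_poly G)`_k = (indep_count G k)%:R.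
Proof.
rewrite /indep_poly -(poly_def _ (fun i => (indep_count G i)%:R)) coef_poly.
(* Beyond [indep_number G] the coefficient is 0 by default, and no independent set is that large. *)
case: leqP => // lt_k; rewrite (_ : indep_count G k = 0%N) //.
apply: eq_card0 => A; rewrite !inE; apply/negP=> /andP[indA /eqP cA].
by move: lt_k; rewrite -cA ltnNge leq_bigmax_cond.
Qed.

(** Reads the degree off the last nonzero count, without computing [indep_number G]. *)
Lemma size_indep_poly (G : sgraph) (n : nat) :
  (forall k, (n < k)%N -> indep_count G k = 0%N) -> (0 < indep_count G n)%N ->
  size (indep_poly G) = n.+1.
Proof.
move=> count_gt count_n; apply/eqP; rewrite eqn_leq; apply/andP; split.
  by apply/leq_sizeP => k ltnk; rewrite coef_indep_poly count_gt.
rewrite ltnNge; apply/negP => /leq_sizeP/(_ _ (leqnn n))/eqP.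
by rewrite coef_indep_poly pnatr_eq0 -leqn0 leqNgt count_n.
Qed.

Lemma indep_poly_nneg (G : sgraph) : indep_poly G \is a polyOver Num.nneg.
Proof. by apply/polyOverP=> k; rewrite coef_indep_poly nnegrE ler0n. Qed.

Local Close Scope ring_scope.

Theorem theorem3p5 (G : sgraph) (S : {set G})
    (S_indep : independent S)
    (nbhd_S : forall A : {set G}, A \subset ~: S -> independent A ->
       #|nbhd A :&: S| = 2 * #|A|) :
  symmetric_poly (indep_poly G) /\ unimodal_poly (indep_poly G).
Proof.
have size_p := size_indep_poly (indep_count_gt S_indep nbhd_S)
  (indep_count_card_gt0 S_indep).
split; split; try exact: indep_poly_nneg.
  by move=> k; rewrite size_p !coef_indep_poly => /(indep_count_sym S_indep nbhd_S) ->.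
(* With the peak at [|S|./2], [i] below it gives [2i < |S|], and [i] at or above it gives
   [|S| <= 2i+1]. *)
exists #|S|./2; rewrite size_p /=; split=> [|i lti|i /andP[lei lti]].
- by lia.
- by rewrite !coef_indep_poly ler_nat (indep_count_mono S_indep nbhd_S) //; lia.
- by rewrite !coef_indep_poly ler_nat (indep_count_anti S_indep nbhd_S) //; lia.
Qed.
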